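(* Let $n\ge 1$, let $\mathcal{Z}=\mathcal{Z}_1\times\dots\times\mathcal{Z}_n$ be a product of measurable spaces, let $S=(X_1,\dots,X_n)$ be a random element of $\mathcal{Z}$ with mutually independent coordinates, and let $f:\mathcal{Z}\to\mathbb{R}$ be measurable with $\mathbb{E}[f(S)^2]<\infty$. Let $\Delta=f(S)-\mathbb{E}[f(S)]$ and let $V$ be the semi-empirical Efron–Stein variance proxy \[ V=\sum_{k=1}^n \mathbb{E}\big[(f(S)-f(S^{(k)}))^2 \,\big|\, X_1,\dots,X_k\big]. \] Then: (i) for every $y>0$ and every $x\ge 2$, \[ \mathbb{P}\Big(|\Delta|\le \sqrt{2(V+y)\big(1+\tfrac12\ln(1+V/y)\big)x}\Big)\ge 1-e^{-x}; \] (ii) for every $x>0$, \[ \mathbb{P}\Big(|\Delta|\le 2\sqrt{(V+\mathbb{E}[V])\,x}\Big)\ge 1-\sqrt2\, e^{-x}. \]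
   Context: $S'=(X_1',\dots,X_n')$ denotes an independent copy of $S$ (independent of $S$, with the same distribution), and $S^{(k)}$ denotes the tuple obtained from $S$ by replacing its $k$-th coordinate $X_k$ by $X_k'$. *)

(* Defs.v *)
From HB Require Import structures.
From mathcomp Require Import all_boot all_order all_algebra.
From mathcomp Require Import all_classical all_reals all_analysis.
Set Implicit Arguments. Unset Strict Implicit. Unset Printing Implicit Defensive.
Import Order.TTheory GRing.Theory Num.Theory.
Local Open Scope classical_set_scope.
Local Open Scope ring_scope.

Definition prod_sigma (n : nat) (d : 'I_n -> measure_display)
  (Z : forall i, measurableType (d i)) : set (set (forall i, Z i)) :=
  <<s [set B | exists i (A : set (Z i)), measurable A /\
                 B = (fun z : forall j, Z j => z i) @^-1` A] >>.

Definition prod_measurable (n : nat) (d : 'I_n -> measure_display)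
  (Z : forall i, measurableType (d i)) (R : realType)
  (f : (forall i, Z i) -> R) : Prop :=
  forall B : set R, measurable B -> @prod_sigma _ _ Z (f @^-1` B).

Definition coord_independent (dO : measure_display) (O : measurableType dO)
  (R : realType) (P : probability O R) (n : nat) (d : 'I_n -> measure_display)
  (Z : forall i, measurableType (d i)) (S : O -> forall i, Z i) : Prop :=
  forall A : forall i, set (Z i), (forall i, measurable (A i)) ->
    P (\bigcap_(i in setT) ((fun w => S w i) @^-1` A i)) =
    (\prod_(i < n) fine (P ((fun w => S w i) @^-1` A i)))%:E.

Definition independent_copy (dO : measure_display) (O : measurableType dO)
  (R : realType) (P : probability O R) (n : nat) (d : 'I_n -> measure_display)
  (Z : forall i, measurableType (d i)) (S S' : O -> forall i, Z i) : Prop :=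
  (forall A, @prod_sigma _ _ Z A -> P (S @^-1` A) = P (S' @^-1` A)) /\
  (forall A B, @prod_sigma _ _ Z A -> @prod_sigma _ _ Z B ->
     P (S @^-1` A `&` S' @^-1` B) = (P (S @^-1` A) * P (S' @^-1` B))%E).

(* sigma(X_1, ..., X_{k+1}) (0-based index k : 'I_n, i.e. coordinates i <= k). *)
Definition sigma_first (dO : measure_display) (O : measurableType dO)
  (n : nat) (d : 'I_n -> measure_display) (Z : forall i, measurableType (d i))
  (S : O -> forall i, Z i) (k : 'I_n) : set (set O) :=
  <<s [set B | exists i (A : set (Z i)), (i <= k)%N /\ measurable A /\
                 B = (fun w => S w i) @^-1` A] >>.

Definition is_cond_exp (dO : measure_display) (O : measurableType dO)
  (R : realType) (P : probability O R) (G : set (set O)) (Y W : O -> R) : Prop :=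
  (forall B : set R, measurable B -> G (W @^-1` B)) /\
  P.-integrable setT (fun w => (W w)%:E) /\
  (forall A, G A -> (\int[P]_(w in A) (W w)%:E = \int[P]_(w in A) (Y w)%:E)%E).

Definition replace_at (dO : measure_display) (O : measurableType dO)
  (n : nat) (d : 'I_n -> measure_display) (Z : forall i, measurableType (d i))
  (S S' : O -> forall i, Z i) (k : 'I_n) : O -> forall i, Z i :=
  fun w i => if i == k then S' w i else S w i.

(* Main.v *)
(* Write f(S) - E f(S) as the sum of its martingale differences along the
   coordinates. Given X_1, ..., X_k, the k-th difference and the k-th summand of
   V are the means of xi and xi^2, where xi compares two copies of f(S) which
   differ in the k-th coordinate only. By Jensen's inequality, the k-th factor
   of E exp(l Delta - l^2 V / 2) is bounded by E exp(l xi - l^2 xi^2 / 2), and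
   this is at most 1 because xi is conditionally symmetric given
   X_1, ..., X_(k-1) and cosh u <= exp(u^2 / 2). Hence
   E exp(l Delta - l^2 V / 2) <= 1 for all l. Integrating l against a centred
   Gaussian of precision y gives
   E [sqrt(y / (V + y)) exp(Delta^2 / (2 (V + y)))] <= 1,
   from which both bounds follow by Markov's inequality; the second one uses
   AM-GM to remove the square root, with y = E V (y decreasing to 0 when
   E V = 0). *)
Require Import Defs.
From HB Require Import structures.
From mathcomp Require Import all_boot all_order all_algebra.
From mathcomp Require Import all_classical all_reals all_analysis.
From mathcomp Require Import measurable_realfun normal_distribution ring lra.
Set Implicit Arguments. Unset Strict Implicit. Unset Printing Implicit Defensive.
Import Order.TTheory GRing.Theory Num.Theory.
Import numFieldNormedType.Exports.
Local Open Scope classical_set_scope.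
Local Open Scope ring_scope.

(** * Exponential inequalities and Gaussian mixtures *)

Section RealInequalities.
Context {R : realType}.
Implicit Types u a : R.

Lemma le_at0_of_derive_le0 (h dh : R -> R) u : 0 <= u ->
  (forall x : R, is_derive x (1 : R) h (dh x)) -> (forall x, 0 < x -> dh x <= 0) ->
  h u <= h 0.
Proof.
move=> u0 hd dh0.
have hD (x : R) : derivable h x 1 by have [] := hd x.
have hE (x : R) : derive1 h x = dh x by rewrite derive1E; apply: derive_val.
apply: (@ler0_derive1_nincry _ h 0) => // [x|].
- by rewrite in_itv /= andbT hE; exact: dh0.
- apply: continuous_subspaceT => x.
  by apply: differentiable_continuous; apply/derivable1_diffP; exact: hD.
Qed.

(** The difference of both sides vanishes at 0 and has derivative [dh], which is nonpositive for
    positive [x]. This fixes the sign of the derivative in the next proof. *)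
Lemma sinh_le_mul_cosh u : 0 <= u ->
  expR u - expR (- u) <= u * (expR u + expR (- u)).
Proof.
move=> u0.
pose h (x : R) := (1 - x) * expR x - (1 + x) * expR (- x).
pose dh (x : R) := x * (expR (- x) - expR x).
have hd (x : R) : is_derive x (1 : R) h (dh x).
  apply: is_derive_eq; rewrite /dh -!/(_ *: _) /GRing.scale /=; ring.
have : h u <= h 0.
  apply: (le_at0_of_derive_le0 u0 hd) => x x0.
  rewrite /dh pmulr_rle0 // subr_le0 ler_expR; lra.
rewrite /h oppr0 expR0; lra.
Qed.

(** Both sides are even in [u], and for [u >= 0] the quotient [2 cosh u / exp (u^2 / 2)] does not
    exceed its value 2 at 0, since its derivative is nonpositive by the preceding inequality. *)
Lemma cosh_le_expR_sqr u : expR u + expR (- u) <= 2 * expR (u ^+ 2 / 2).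
Proof.
wlog u0 : u / 0 <= u.
  move=> H; have [/H//|/ltW u0] := leP 0 u.
  by have := H (- u); rewrite oppr_ge0 opprK sqrrN addrC; apply.
pose h (x : R) := (expR x + expR (- x)) * expR (- (x ^+ 2 / 2)).
pose dh (x : R) :=
  (expR x - expR (- x) - x * (expR x + expR (- x))) * expR (- (x ^+ 2 / 2)).
have hd (x : R) : is_derive x (1 : R) h (dh x).
  apply: is_derive_eq; rewrite /dh -!/(_ *: _) /GRing.scale /=; by field.
have : h u <= h 0.
  apply: (le_at0_of_derive_le0 u0 hd) => x x0.
  rewrite pmulr_lle0 ?expR_gt0 // subr_le0; apply: sinh_le_mul_cosh; exact: ltW.
rewrite /h oppr0 expr0n /= mul0r oppr0 !expR0 mulr1 [expR (- (_ / _))]expRN.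
by rewrite ler_pdivrMr ?expR_gt0.
Qed.

Lemma normal_pdf_precision (m p x : R) : 0 < p ->
  normal_pdf m (Num.sqrt p)^-1 x =
  Num.sqrt p / Num.sqrt ((pi : R) *+ 2) * expR (- (p * (x - m) ^+ 2 / 2)).
Proof.
move=> p0; have sp0 : Num.sqrt p != 0 by rewrite gt_eqF // sqrtr_gt0.
rewrite normal_pdfE ?invr_eq0 // /normal_peak /normal_fun exprVn sqr_sqrtr ?ltW //.
rewrite -mulrnAr sqrtrM ?invr_ge0 ?ltW // sqrtrV ?ltW // invfM invrK.
congr (_ * expR _); field.
by rewrite gt_eqF.
Qed.

(** Completing the square in [l]: the tilted centred Gaussian of precision [y] is a Gaussian of
    precision [v + y] and mean [a / (v + y)], up to a factor free of [l]. Integrating out [l] leaves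
    that factor. *)
Lemma normal_pdf_tilt (y v a l : R) : 0 < y -> 0 <= v ->
  normal_pdf 0 (Num.sqrt y)^-1 l * expR (l * a - l ^+ 2 / 2 * v) =
  Num.sqrt (y / (v + y)) * expR (a ^+ 2 / (2 * (v + y))) *
    normal_pdf (a / (v + y)) (Num.sqrt (v + y))^-1 l.
Proof.
move=> y0 v0; have vy0 : 0 < v + y by rewrite ltr_wpDl.
rewrite !normal_pdf_precision // sqrtrM ?ltW // sqrtrV ?ltW //.
have svy : Num.sqrt (v + y) != 0 by rewrite gt_eqF // sqrtr_gt0.
have -> : expR (a ^+ 2 / (2 * (v + y))) = expR (- (y * (l - 0) ^+ 2 / 2)) *
    expR (l * a - l ^+ 2 / 2 * v) / expR (- ((v + y) * (l - a / (v + y)) ^+ 2 / 2)).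
  rewrite -expRN -!expRD; congr expR; field.
  by rewrite gt_eqF.
have sp : Num.sqrt ((pi : R) *+ 2) != 0.
  by rewrite gt_eqF // sqrtr_gt0 pmulrn_lgt0 // pi_gt0.
have ex z : expR z != 0 :> R by rewrite gt_eqF // expR_gt0.
by field; rewrite ?svy ?sp ?ex.
Qed.

End RealInequalities.

Section Probability.
Context {R : realType} d {T : measurableType d} (P : probability T R).

(** The tangent of [exp] at the mean [m] lies below [exp], and along [psi] it integrates to
    [exp m]. *)
Lemma expR_jensen (psi : T -> R) : P.-integrable setT (fun w => (psi w)%:E) ->
  ((expR (fine (\int[P]_w (psi w)%:E)))%:E <= \int[P]_w (expR (psi w))%:E)%E.
Proof.
move=> ipsi; set m := fine _.
have mE : (\int[P]_w (psi w)%:E)%E = m%:E by rewrite fineK // integrable_fin_num.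
have mpsi : measurable_fun setT psi by apply/measurable_EFinP; exact: measurable_int ipsi.
(* An infinite right-hand side is trivial; otherwise [exp psi] is integrable, which the comparison
   of integrals below relies on. *)
have [->|noo] := eqVneq (\int[P]_w (expR (psi w))%:E)%E +oo%E; first by rewrite leey.
have iexp : P.-integrable setT (fun w => (expR (psi w))%:E).
  apply/integrableP; split.
    by apply/measurable_EFinP; exact: measurableT_comp.
  under eq_integral do rewrite gee0_abs ?lee_fin ?expR_ge0 //.
  by rewrite ltey.
have icst : P.-integrable setT (fun w => (expR m * (1 - m))%:E).
  by apply: finite_measure_integrable_cst.
have ilin : P.-integrable setT (fun w => (expR m)%:E * (psi w)%:E)%E.
  exact: integrableZl.
have -> : (expR m)%:E = (\int[P]_w ((expR m * (1 - m))%:E + (expR m)%:E * (psi w)%:E))%E.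
  rewrite integralD //= integral_cst // integralZl // mE.
  rewrite [X in (_ * X + _)%E](probability_setT P) mule1 -EFinM -EFinD; congr (_%:E); ring.
apply: le_integral => //; first exact: integrableD.
move=> w _; rewrite -EFinM -EFinD lee_fin -mulrDr.
have -> : expR (psi w) = expR m * expR (psi w - m) by rewrite -expRD addrC subrK.
rewrite ler_pM2l ?expR_gt0 //.
by apply: le_trans (expR_ge1Dx _); lra.
Qed.

Lemma measurable_set_lt (f g : T -> R) : measurable_fun setT f ->
  measurable_fun setT g -> measurable [set w | f w < g w].
Proof.
move=> /measurable_EFinP mf /measurable_EFinP mg.
by have := measurable_lte measurableT mf mg; rewrite setTI.
Qed.

Lemma markov_integral (X : T -> R) (E : set T) (a c : R) :
  measurable E -> measurable_fun setT X -> (forall w, 0 <= X w) -> 0 < a ->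
  (forall w, E w -> a <= X w) -> (\int[P]_w (X w)%:E <= c%:E)%E ->
  (P E <= (c / a)%:E)%E.
Proof.
move=> mE mX X0 a0 EX Xc.
rewrite EFinM lee_pdivlMr //; apply: le_trans Xc; rewrite muleC.
have mEX : measurable_fun setT (fun w => (X w)%:E) by exact/measurable_EFinP.
rewrite -integral_cst //; have a0' := ltW a0.
apply: (@le_trans _ _ (\int[P]_(w in E) (X w)%:E)%E).
  apply: ge0_le_integral => //.
  exact: measurable_funTS.
apply: ge0_subset_integral => //.
by move=> w _; rewrite lee_fin.
Qed.

(** * Mixing over a centred Gaussian parameter *)

Section Mixture.
Variables (A W : T -> R) (y : R).
Hypotheses (mA : measurable_fun setT A) (mW : measurable_fun setT W).
Hypotheses (W0 : forall w, 0 <= W w) (y0 : 0 < y).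
Hypothesis subgauss :
  forall l, (\int[P]_w (expR (l * A w - l ^+ 2 / 2 * W w))%:E <= 1)%E.

(** Closed form of the integral of [exp (l A - l^2 W / 2)] over [l] against the centred Gaussian of
    precision [y]. *)
Definition mixture w : R :=
  Num.sqrt (y / (W w + y)) * expR (A w ^+ 2 / (2 * (W w + y))).

Lemma measurable_mixture : measurable_fun setT mixture.
Proof.
have mWy : measurable_fun setT (fun w => W w + y) by exact: measurable_funD.
have mV : measurable_fun setT (fun w => (W w + y)^-1).
  under eq_fun do rewrite -powR_inv1 ?addr_ge0 // ?ltW //.
  exact: measurableT_comp (measurable_powR _) mWy.
have mX : measurable_fun setT (fun w => (2 * (W w + y))^-1).
  by under eq_fun do rewrite invfM; exact: measurable_funM.
apply: measurable_funM.
  apply: measurableT_comp.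
    by apply: continuous_measurable_fun; exact: sqrt_continuous.
  exact: measurable_funM.
apply: measurableT_comp => //; apply: measurable_funM; first exact: measurable_funX.
exact: mX.
Qed.

Lemma mixture_ge0 w : 0 <= mixture w.
Proof. by rewrite mulr_ge0 ?sqrtr_ge0 ?expR_ge0. Qed.

(** By Tonelli the integrals over [w] and [l] may be swapped; the inner integral over [w] is then at
    most the Gaussian density, by [subgauss], and that density has mass 1. *)
Lemma integral_mixture_le1 : (\int[P]_w (mixture w)%:E <= 1)%E.
Proof.
pose F (p : T * R) : \bar R := (normal_pdf 0 (Num.sqrt y)^-1 p.2 *
  expR (p.2 * A p.1 - p.2 ^+ 2 / 2 * W p.1))%:E.
have mF : measurable_fun setT F.
  apply/measurable_EFinP; apply: measurable_funM.
    apply: measurableT_comp; [exact: measurable_normal_pdf|exact: measurable_snd].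
  apply: measurableT_comp => //; apply: measurable_funB; apply: measurable_funM => //.
  - exact: measurableT_comp mA measurable_fst.
  - by apply: measurable_funM => //; exact: measurable_funX.
  - exact: measurableT_comp mW measurable_fst.
have F0 p : (0 <= F p)%E by rewrite lee_fin mulr_ge0 ?normal_pdf_ge0 ?expR_ge0.
have -> : (\int[P]_w (mixture w)%:E =
    \int[P]_w \int[@lebesgue_measure R]_l F (w, l))%E.
  apply: eq_integral => w _; rewrite /F /=.
  under eq_integral do rewrite normal_pdf_tilt // EFinM.
  rewrite ge0_integralZl //=.
  - by rewrite integral_normal_pdf mule1.
  - by apply/measurable_EFinP; exact: measurable_normal_pdf.
  - by move=> l _; rewrite lee_fin normal_pdf_ge0.
have -> : (\int[P]_w \int[@lebesgue_measure R]_l F (w, l) =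
    \int[@lebesgue_measure R]_l \int[P]_w F (w, l))%E.
  by apply: (@fubini_tonelli _ _ _ _ _ P (@lebesgue_measure R) F).
rewrite -(integral_normal_pdf 0 (Num.sqrt y)^-1).
apply: ge0_le_integral => //.
- by move=> l _; apply: integral_ge0.
- exact: measurable_fun_fubini_tonelli_G.
- by apply/measurable_EFinP; exact: measurable_normal_pdf.
move=> l _; rewrite /F /=.
under eq_integral do rewrite EFinM.
rewrite ge0_integralZl //=; last 2 first.
- apply/measurable_EFinP; apply: measurableT_comp => //.
  by apply: measurable_funB; exact: measurable_funM.
- by rewrite lee_fin normal_pdf_ge0.
rewrite -[leRHS]mule1; apply: lee_wpmul2l => //.
by rewrite lee_fin normal_pdf_ge0.
Qed.

(** With [L = ln (1 + W / y)] the mixture equals [exp (A^2 / (2 (W + y)) - L / 2)]. On the event the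
    exponent is at least [(1 + L / 2) x - L / 2], hence at least [x] because [1 <= x] and [L >= 0];
    Markov's inequality concludes. *)
Lemma mixture_tail x : 1 <= x ->
  (P [set w | (2 * (W w + y) * (1 + ln (1 + W w / y) / 2) * x < A w ^+ 2)%R]
     <= (expR (- x))%:E)%E.
Proof.
move=> x1; set E := [set w | _].
have mE : measurable E.
  apply: measurable_set_lt; last exact: measurable_funX.
  apply: measurable_funM => //; apply: measurable_funM.
    by apply: measurable_funM => //; exact: measurable_funD.
  apply: measurable_funD => //; apply: measurable_funM => //.
  apply: measurableT_comp; first exact: measurable_ln.
  by apply: measurable_funD => //; exact: measurable_funM.
rewrite expRN -[_^-1]mul1r.
apply: markov_integral integral_mixture_le1 => //.
- exact: measurable_mixture.
- exact: mixture_ge0.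
- exact: expR_gt0.
move=> w; rewrite /E /= => Ew.
have Wy : 0 < W w + y by rewrite ltr_wpDl.
have q0 : 0 < y / (W w + y) by rewrite divr_gt0.
have -> : mixture w = expR (A w ^+ 2 / (2 * (W w + y)) - ln (1 + W w / y) / 2).
  rewrite /mixture -[X in Num.sqrt X]lnK ?posrE //.
  rewrite expRD mulrC; congr (_ * _).
  apply/eqP; rewrite -(@eqrXn2 _ 2) ?sqrtr_ge0 ?expR_ge0 // sqr_sqrtr ?expR_ge0 //.
  rewrite -expRM_natl; apply/eqP; congr expR.
  have -> : y / (W w + y) = (1 + W w / y)^-1.
    by field; rewrite !gt_eqF // addrC.
  rewrite lnV ?posrE ?ltr_wpDr ?divr_ge0 // ?ltW //; by field.
rewrite ler_expR; set L := ln _ in Ew *.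
have L0 : 0 <= L by apply: ln_ge0; rewrite lerDl divr_ge0 // ltW.
have : (1 + L / 2) * x <= A w ^+ 2 / (2 * (W w + y)).
  rewrite ler_pdivlMr ?mulr_gt0 //; apply: le_trans (ltW Ew).
  by rewrite le_eqVlt; apply/orP; left; apply/eqP; ring.
suff : L / 2 <= L / 2 * x by lra.
by rewrite ler_peMr // divr_ge0.
Qed.

(** Markov's inequality for [G], the average of the mixture and of [1 + W / (2 y)]: it is at least
    [exp x] on the event, and its expectation is at most [(1 + 3 / 2) / 2 = 5 / 4], which is below
    [sqrt 2]. *)
Lemma mixture_tail_mean x : (\int[P]_w (W w)%:E <= y%:E)%E ->
  (P [set w | (4 * (W w + y) * x < A w ^+ 2)%R]
     <= (Num.sqrt 2 * expR (- x))%:E)%E.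
Proof.
move=> EW; set E := [set w | _].
have mE : measurable E.
  apply: measurable_set_lt; last exact: measurable_funX.
  by apply: measurable_funM => //; apply: measurable_funM => //; exact: measurable_funD.
rewrite expRN.
pose G w : R := (mixture w + (1 + W w / (2 * y))) / 2.
have W'0 w : 0 <= 1 + W w / (2 * y).
  by rewrite addr_ge0 // divr_ge0 // mulr_ge0 // ltW.
have mW' : measurable_fun setT (fun w => 1 + W w / (2 * y)).
  by apply: measurable_funD => //; exact: measurable_funM.
apply: (@markov_integral G).
- exact: mE.
- by apply: measurable_funM => //; apply: measurable_funD => //; exact: measurable_mixture.
- by move=> w; rewrite divr_ge0 // addr_ge0 // mixture_ge0.
- exact: expR_gt0.
- move=> w; rewrite /E /= => Ew.
  have Wy : 0 < W w + y by rewrite ltr_wpDl.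
  (* AM-GM applied to the factorisation of exp(A^2/(4(W+y))) as
     sqrt(mixture) * (1 + W/y)^(1/4), then sqrt(1 + u) <= 1 + u/2. *)
  pose s := Num.sqrt ((W w + y) / y).
  pose e := expR (A w ^+ 2 / (4 * (W w + y))).
  have s0 : 0 < s by rewrite sqrtr_gt0 divr_gt0.
  have mixE : mixture w = e ^+ 2 / s.
    rewrite /mixture /e /s -expRM_natl -[y / _]invf_div sqrtrV; last first.
      by rewrite divr_ge0 // ltW.
    by rewrite mulrC; congr (expR _ / _); field; rewrite gt_eqF.
  have sle : s <= 1 + W w / (2 * y).
    rewrite -(ler_pXn2r (n := 2)) ?nnegrE ?sqrtr_ge0 // sqr_sqrtr; last first.
      by rewrite divr_ge0 // ltW.
    rewrite -subr_ge0; have -> : (1 + W w / (2 * y)) ^+ 2 - (W w + y) / y =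
        (W w / (2 * y)) ^+ 2 by field; rewrite gt_eqF.
    exact: sqr_ge0.
  apply: (@le_trans _ _ e).
    rewrite ler_expR ler_pdivlMr ?mulr_gt0 //; apply: le_trans (ltW Ew).
    by rewrite mulrC.
  rewrite /G mixE ler_pdivlMr //.
  apply: (@le_trans _ _ (e ^+ 2 / s + s)); last by rewrite lerD2l.
  rewrite -subr_ge0; have -> : e ^+ 2 / s + s - e * 2 = (e - s) ^+ 2 / s.
    by field; rewrite gt_eqF.
  by rewrite divr_ge0 ?sqr_ge0 // ltW.
have mE1 : measurable_fun setT (fun w => (mixture w)%:E).
  by apply/measurable_EFinP; exact: measurable_mixture.
have mE2 : measurable_fun setT (fun w => (1 + W w / (2 * y))%:E).
  exact/measurable_EFinP.
under eq_integral do rewrite /G EFinM EFinD.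
rewrite ge0_integralZr //; last 2 first.
- exact: emeasurable_funD.
- by move=> w _; rewrite -EFinD lee_fin addr_ge0 // mixture_ge0.
rewrite ge0_integralD //; last 2 first.
- by move=> w _; rewrite lee_fin mixture_ge0.
- by move=> w _; rewrite lee_fin.
have -> : (\int[P]_w (1 + W w / (2 * y))%:E =
    1 + (\int[P]_w (W w)%:E) * ((2 * y)^-1)%:E)%E.
  under eq_integral do rewrite EFinD EFinM.
  rewrite ge0_integralD //; last 2 first.
  - by move=> w _; rewrite -EFinM lee_fin divr_ge0 // mulr_ge0 // ltW.
  - by apply/measurable_EFinP; exact: measurable_funM.
  rewrite integral_cst // ge0_integralZr //; last 3 first.
  - exact/measurable_EFinP.
  - by move=> w _; rewrite lee_fin.
  - by rewrite lee_fin invr_ge0 mulr_ge0 // ltW.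
  by rewrite [X in (_ * X + _)%E](probability_setT P) mule1.
have : (1 + (\int[P]_w (W w)%:E) * ((2 * y)^-1)%:E <= (3 / 2)%:E)%E.
  have -> : (3 / 2)%:E = (1 + y%:E * ((2 * y)^-1)%:E)%E :> \bar R.
    by rewrite -EFinM -EFinD; congr (_%:E); field; rewrite gt_eqF.
  by rewrite leeD2l // lee_wpmul2r // lee_fin invr_ge0 mulr_ge0 // ltW.
move=> /(leeD integral_mixture_le1) H.
apply: (@le_trans _ _ ((1 + (3 / 2)%:E) * (2^-1)%:E)%E).
  by rewrite lee_wpmul2r // lee_fin invr_ge0.
rewrite -EFinD -EFinM lee_fin.
rewrite -(ler_pXn2r (n := 2)) ?nnegrE ?sqrtr_ge0 //.
rewrite sqr_sqrtr //; lra.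
Qed.

End Mixture.
End Probability.

(** * Products of measurable spaces *)

Section ProductSpace.
Context {n : nat} {d : 'I_n -> measure_display}.
Variable Z : forall i, measurableType (d i).

Definition cylinders : set (set (forall i, Z i)) :=
  [set B | exists i (A : set (Z i)), measurable A /\
                 B = (fun z : forall j, Z j => z i) @^-1` A].

(** Carrying [prod_sigma] on a type gives access to product measures and Tonelli for the dependent
    product; [prod_measurable f] becomes ordinary measurability on it. *)
Definition prodT : measurableType cylinders.-sigma :=
  g_sigma_algebraType cylinders.

Lemma measurable_coord (i : 'I_n) : measurable_fun setT (fun z : prodT => z i).
Proof.
move=> _ A mA; rewrite setTI; apply: sub_sigma_algebra; by exists i, A.
Qed.

Lemma measurable_prodT dT (T : measurableType dT) (h : T -> prodT) :
  (forall i, measurable_fun setT (fun t => h t i)) -> measurable_fun setT h.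
Proof.
move=> mh; apply: (@measurability _ _ T prodT setT h cylinders erefl).
move=> _ [_ [i [A [mA ->]]] <-].
by have := mh i measurableT A mA.
Qed.

Definition mix (Q : pred 'I_n) (z z' : prodT) : prodT :=
  fun i => if Q i then z i else z' i.

(** An involution: it swaps the coordinates outside [Q] between the two points and keeps those in
    [Q]. *)
Definition exchange Q (p : prodT * prodT) := (mix Q p.1 p.2, mix Q p.2 p.1).

Lemma measurable_mix dT (T : measurableType dT) Q (g h : T -> prodT) :
  measurable_fun setT g -> measurable_fun setT h ->
  measurable_fun setT (fun t => mix Q (g t) (h t)).
Proof.
move=> mg mh; apply: measurable_prodT => i; rewrite /mix; case: (Q i).
  exact: (measurableT_comp (@measurable_coord i) mg).
exact: (measurableT_comp (@measurable_coord i) mh).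
Qed.

Lemma measurable_exchange Q : measurable_fun setT (exchange Q).
Proof.
apply: measurable_fun_pair; apply: measurable_mix;
  by [exact: measurable_fst|exact: measurable_snd].
Qed.

Definition box (A : forall i, set (Z i)) : set prodT :=
  [set z | forall i, A i (z i)].

Definition boxes : set (set prodT) :=
  [set B | exists2 A, forall i, measurable (A i) & B = box A].

Lemma measurable_box A : (forall i, measurable (A i)) -> measurable (box A).
Proof.
move=> mA; have -> : box A = \bigcap_(i in setT) ((fun z : prodT => z i) @^-1` A i).
  by apply/seteqP; split=> [z zA i _|z zA i]; [exact: zA|exact: zA].
apply: fin_bigcap_measurable; first exact: finite_finset.
by move=> i _; have := measurable_coord (i := i) measurableT (mA i); rewrite setTI.
Qed.

Lemma box_cylinder i (A : set (Z i)) : measurable A ->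
  boxes ((fun z : prodT => z i) @^-1` A).
Proof.
move=> mA; exists (eqtype.dfwith (fun j => [set: Z j]) A).
  move=> j; case: eqtype.dfwithP => // j'; exact: measurableT.
apply/seteqP; split=> z /=.
  by move=> zA j; case: eqtype.dfwithP.
by move=> /(_ i); rewrite eqtype.dfwith_in.
Qed.

Lemma boxT : boxes setT.
Proof.
exists (fun i => setT) => [i|]; first exact: measurableT.
by apply/seteqP; split.
Qed.

Lemma boxI (A B : forall i, set (Z i)) :
  box A `&` box B = box (fun i => A i `&` B i).
Proof.
apply/seteqP; split=> [z [zA zB] i|z zAB]; first by split; [exact: zA|exact: zB].
by split=> i; have [] := zAB i.
Qed.

Definition box_rectangles : set (set (prodT * prodT)) :=
  [set A `*` B | A in boxes & B in boxes].

(** This provides the generating family for the uniqueness of measures. For the nontrivial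
    inclusion, both projections are measurable for the sigma-algebra generated by the rectangles,
    hence so is their pairing, the identity. *)
Lemma measurable_box_rectangles :
  @measurable _ (prodT * prodT)%type = <<s box_rectangles >>.
Proof.
apply/seteqP; split; last first.
  apply: smallest_sub; first exact: sigma_algebra_measurable.
  move=> _ [_ [A mA ->] [_ [B mB ->] <-]].
  by apply: measurableX; exact: measurable_box.
pose T := g_sigma_algebraType box_rectangles.
have mfst : measurable_fun setT (fst : T -> prodT).
  apply: measurable_prodT => i _ A mA; rewrite setTI.
  apply: sub_sigma_algebra; exists ((fun z : prodT => z i) @^-1` A).
    exact: box_cylinder.
  by exists setT; [exact: boxT|apply/seteqP; split=> -[? ?] //= []].
have msnd : measurable_fun setT (snd : T -> prodT).
  apply: measurable_prodT => i _ A mA; rewrite setTI.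
  apply: sub_sigma_algebra; exists setT; first exact: boxT.
  exists ((fun z : prodT => z i) @^-1` A); first exact: box_cylinder.
  by apply/seteqP; split=> -[? ?] //= [].
move=> A mA.
have := measurable_fun_pair mfst msnd measurableT mA; rewrite setTI.
by congr (<<s _ >> _); apply/seteqP; split => -[].
Qed.

Lemma box_rectanglesI : setI_closed box_rectangles.
Proof.
move=> _ _ [_ [A mA ->] [_ [B mB ->] <-]] [_ [A' mA' ->] [_ [B' mB' ->] <-]].
rewrite -setXI !boxI.
exists (box (fun i => A i `&` A' i)).
  by exists (fun i => A i `&` A' i) => // i; exact: measurableI.
exists (box (fun i => B i `&` B' i)) => //.
by exists (fun i => B i `&` B' i) => // i; exact: measurableI.
Qed.

Section Independent.
Context {R : realType} (mu : probability prodT R) (m : forall i, set (Z i) -> R).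
Arguments m : clear implicits.
Hypothesis mu_box : forall A, (forall i, measurable (A i)) ->
  mu (box A) = (\prod_(i < n) m i (A i))%:E.

(* The coordinates of two independent draws may be exchanged freely; every
   distributional identity below is an instance of this invariance. *)
Lemma exchange_invariant Q (X : set (prodT * prodT)) : measurable X ->
  (mu \x mu)%E (exchange Q @^-1` X) = (mu \x mu)%E X.
Proof.
move=> mX.
pose E : {mfun (prodT * prodT)%type >-> (prodT * prodT)%type} :=
  HB.pack (exchange Q) (isMeasurableFun.Build _ _ _ _ _ (measurable_exchange Q)).
apply: (measure_unique box_rectangles (fun=> setT) measurable_box_rectangles
  box_rectanglesI _ _ (distribution (mu \x mu)%E E) (mu \x mu)%E) => //.
- by move=> _; exists setT; [exact: boxT|exists setT; [exact: boxT|rewrite setXTT]].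
- by apply/seteqP; split=> // p _; exists 0%N.
- move=> _ [_ [A mA ->] [_ [B mB ->] <-]].
  rewrite /distribution /pushforward /=.
  pose C i := if Q i then A i else B i.
  pose D i := if Q i then B i else A i.
  have mC i : measurable (C i) by rewrite /C; case: (Q i).
  have mD i : measurable (D i) by rewrite /D; case: (Q i).
  have -> : exchange Q @^-1` (box A `*` box B) = box C `*` box D.
    apply/seteqP; split=> -[z z'] /= [zA zB]; split=> i /=;
      move: (zA i) (zB i); rewrite /C /D /mix /=; by case: (Q i).
  rewrite !product_measure1E; try exact: measurable_box.
  rewrite [X in (X * _ = _)%E](mu_box mC) [X in (_ * X = _)%E](mu_box mD).
  rewrite [X in (_ = X * _)%E](mu_box mA) [X in (_ = _ * X)%E](mu_box mB).
  rewrite -!EFinM -!big_split /=; congr (_%:E).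
  apply: eq_bigr => i _; rewrite /C /D; case: (Q i) => //.
  by rewrite mulrC.
- move=> _; rewrite /distribution /pushforward /=.
  exact: le_lt_trans (probability_le1 (mu \x mu)%E measurableT) (ltry _).
Qed.

Lemma integral_exchange (Q : pred 'I_n) (phi : prodT * prodT -> \bar R) :
  measurable_fun [set: prodT * prodT] phi -> (forall p, (0 <= phi p)%E) ->
  (\int[mu \x mu]_p phi (exchange Q p) = \int[mu \x mu]_p phi p)%E.
Proof.
move=> mphi phi0.
rewrite -(@ge0_integral_pushforward _ _ _ _ _ _ (measurable_exchange Q) _ setT) //.
apply: eq_measure_integral => [|mE A mA _]; first exact: measurable_exchange.
exact: exchange_invariant.
Qed.

(** [mix Q z z'] is the first component of the exchanged pair, so it has law [mu] when [z] and [z']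
    are independent draws from [mu]. *)
Lemma integral_mix (Q : pred 'I_n) (phi : prodT -> \bar R) :
  measurable_fun [set: prodT] phi -> (forall z, (0 <= phi z)%E) ->
  (\int[mu]_z \int[mu]_z' phi (mix Q z z') = \int[mu]_z phi z)%E.
Proof.
move=> mphi phi0.
have mphi1 : measurable_fun setT (phi \o (fst : prodT * prodT -> prodT)).
  exact: measurableT_comp.
rewrite -(fubini_tonelli1 (fun p => phi (mix Q p.1 p.2))) //; last first.
  apply: measurableT_comp => //.
  by apply: measurable_mix; [exact: measurable_fst|exact: measurable_snd].
transitivity (\int[mu \x mu]_p (phi \o fst) p)%E.
  exact: (integral_exchange Q mphi1 (fun p => phi0 p.1)).
rewrite (fubini_tonelli1 (phi \o fst)) //; last by move=> p; exact: phi0.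
apply: eq_integral => z _; rewrite /fubini_F /= integral_cst //.
by rewrite [X in (_ * X)%E](probability_setT mu) mule1.
Qed.

End Independent.
End ProductSpace.

(** * The exponential supermartingale *)

Lemma integrable_of_sqr {R : realType} d {T : measurableType d}
    (P : probability T R) (h : T -> R) : measurable_fun setT h ->
  P.-integrable setT (fun w => (h w ^+ 2)%:E) ->
  P.-integrable setT (fun w => (h w)%:E).
Proof.
move=> mh ih2; apply: (@le_integrable _ _ _ P setT _ _ (fun w => 1 + (h w ^+ 2)%:E)%E) => //.
- exact/measurable_EFinP.
- move=> w _; rewrite /= lee_fin.
  rewrite [leRHS]ger0_norm ?addr_ge0 ?sqr_ge0 // -(real_normK (num_real (h w))).
  by have := sqr_ge0 (`|h w| - 1); have := sqr_ge0 `|h w|; lra.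
- by apply: integrableD => //; exact: finite_measure_integrable_cst.
Qed.

Section Subgaussian.
Context {n : nat} {d : 'I_n -> measure_display} {Z : forall i, measurableType (d i)}.
Context {R : realType} (mu : probability (prodT Z) R).
Variable m : forall i, set (Z i) -> R.
Arguments m : clear implicits.
Hypothesis mu_box : forall A, (forall i, measurable (A i)) ->
  mu (box A) = (\prod_(i < n) m i (A i))%:E.

(** Averaging over [z'] integrates out all coordinates of index at least [k], which amounts to
    conditioning on the first [k] coordinates. *)
Definition splice (k : nat) (z z' : prodT Z) : prodT Z :=
  mix (fun i : 'I_n => (i < k)%N) z z'.

(** Used to show that functions of [splice k z] depend on the first [k] coordinates of [z] only. *)
Lemma splice_mix (k : nat) (Q : pred 'I_n) z z' y :
  (forall i : 'I_n, (i < k)%N -> Q i) -> splice k (mix Q z z') y = splice k z y.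
Proof.
move=> kQ; apply: functional_extensionality_dep => i; rewrite /splice /mix.
by case: ifP => // ik; rewrite kQ.
Qed.

Lemma splice0 z z' : splice 0 z z' = z'.
Proof. by apply: functional_extensionality_dep. Qed.

Lemma splice_all z z' : splice n z z' = z.
Proof.
by apply: functional_extensionality_dep => i; rewrite /splice /mix ltn_ord.
Qed.

(** For this [Q] the exchange swaps coordinate [k] alone, the only one at which the two splices
    differ. It turns [increment k] into its opposite, which is the conditional symmetry. *)
Lemma splice_exchange (k : 'I_n) z z' (Q := predC1 k) :
  (splice k.+1 (mix Q z z') (mix Q z' z) = splice k z z') *
  (splice k (mix Q z z') (mix Q z' z) = splice k.+1 z z').
Proof.
split; apply: functional_extensionality_dep => i;
  rewrite /splice /mix /Q /= ltnS -val_eqE /=; by case: ltngtP.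
Qed.

Lemma measurable_splice k :
  measurable_fun setT (fun p : prodT Z * prodT Z => splice k p.1 p.2).
Proof. by apply: measurable_mix; [exact: measurable_fst|exact: measurable_snd]. Qed.

Lemma measurable_splice1 k z : measurable_fun setT (splice k z).
Proof. by apply: measurable_mix; [exact: measurable_cst|exact: measurable_id]. Qed.

Lemma integrable_splice k (phi : prodT Z -> \bar R) : mu.-integrable setT phi ->
  (mu \x mu)%E.-integrable setT (fun p => phi (splice k p.1 p.2)).
Proof.
move=> /integrableP[mphi iphi].
have mphik : measurable_fun setT (fun p : prodT Z * prodT Z => phi (splice k p.1 p.2)).
  exact: measurableT_comp mphi (measurable_splice k).
apply/integrable12ltyP => //=.
rewrite (integral_mix mu_box _ (phi := fun z => `|phi z|%E)) //.
exact: measurableT_comp.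
Qed.

Variable f : prodT Z -> R.
Hypothesis mf : measurable_fun setT f.
Hypothesis if2 : mu.-integrable setT (fun z => (f z ^+ 2)%:E).

Let iff : mu.-integrable setT (fun z => (f z)%:E).
Proof. exact: integrable_of_sqr. Qed.

(* [tail_mean k] and [evariance k] at [S] are versions of E[f(S) | X_1, ..., X_k]
   and of the (k+1)-st summand of V; one independent copy [z'] suffices for the
   latter because X'_(k+1) and X_(k+2), ..., X_n occupy distinct coordinates.
   Both integrals may be undefined or infinite on a null set, where [fine]
   returns 0. *)
Definition tail_mean k z : R := fine (\int[mu]_z' (f (splice k z z'))%:E)%E.

Definition increment k z z' : R := f (splice k.+1 z z') - f (splice k z z').

Definition evariance k z : \bar R := (\int[mu]_z' (increment k z z' ^+ 2)%:E)%E.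

Lemma measurable_tail_mean k : measurable_fun setT (tail_mean k).
Proof.
apply: measurableT_comp; first exact: fine_measurable.
exact: measurable_fubini_F (integrable_splice k iff).
Qed.

Lemma measurable_increment k :
  measurable_fun setT (fun p : prodT Z * prodT Z => increment k p.1 p.2).
Proof.
by apply: measurable_funB; apply: measurableT_comp => //; exact: measurable_splice.
Qed.

Lemma measurable_increment1 k z : measurable_fun setT (increment k z).
Proof.
by apply: measurable_funB; apply: measurableT_comp => //; exact: measurable_splice1.
Qed.

Lemma measurable_evariance k : measurable_fun setT (evariance k).
Proof.
pose F (p : prodT Z * prodT Z) := ((increment k p.1 p.2) ^+ 2)%:E.
apply: (measurable_fun_fubini_tonelli_F F).
  by apply/measurable_EFinP; apply: measurable_funX; exact: measurable_increment.
by move=> p; rewrite lee_fin sqr_ge0.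
Qed.

Lemma evariance_ge0 k z : (0 <= evariance k z)%E.
Proof. by apply: integral_ge0 => y _; rewrite lee_fin sqr_ge0. Qed.

(** [evariance j] depends on the coordinates up to and including index [j], so the compensator is
    adapted to the first [k] coordinates but in general not predictable. *)
Definition supermartingale l k z : R :=
  expR (l * tail_mean k z - l ^+ 2 / 2 * \sum_(j < k) fine (evariance j z)).

Lemma measurable_supermartingale l k : measurable_fun setT (supermartingale l k).
Proof.
apply: measurableT_comp => //; apply: measurable_funB.
  by apply: measurable_funM => //; exact: measurable_tail_mean.
apply: measurable_funM => //; apply: measurable_sum => j.
apply: measurableT_comp; [exact: fine_measurable|exact: measurable_evariance].
Qed.

(** Adaptedness to the first [k] coordinates: only splices of order at most [k] occur, and these
    ignore the later coordinates of [z]. *)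
Lemma supermartingale_mix l k (Q : pred 'I_n) z z' :
  (forall i : 'I_n, (i < k)%N -> Q i) ->
  supermartingale l k (mix Q z z') = supermartingale l k z.
Proof.
move=> kQ; rewrite /supermartingale /tail_mean.
under eq_integral do rewrite splice_mix //.
congr (expR (_ - _ * _)); apply: eq_bigr => j _; congr fine.
apply: eq_integral => y _; rewrite /increment.
by rewrite !splice_mix // => i ij; apply: kQ; apply: leq_trans ij _ => //; apply: ltnW.
Qed.

Definition gauss_weight (l t : R) := expR (l * t - l ^+ 2 / 2 * t ^+ 2).

Lemma gauss_weightN l t : gauss_weight l t + gauss_weight l (- t) <= 2.
Proof.
rewrite /gauss_weight sqrrN !expRD -mulrDl.
have -> : l * - t = - (l * t) by ring.
rewrite [X in _ * X <= _]expRN ler_pdivrMr ?expR_gt0 //.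
apply: le_trans (cosh_le_expR_sqr _) _.
by rewrite le_eqVlt; apply/orP; left; apply/eqP; congr (_ * expR _); field.
Qed.

Lemma measurable_gauss_weight l : measurable_fun setT (gauss_weight l).
Proof.
apply: measurableT_comp => //; apply: measurable_funB; first exact: measurable_funM.
by apply: measurable_funM => //; exact: measurable_funX.
Qed.

(** For [xi = increment k z z'], the mean of [l xi - l^2 xi^2 / 2] over [z'] is exactly the change
    of the exponent from stage [k] to stage [k + 1]; Jensen's inequality takes the mean out of
    [exp]. *)
Lemma supermartingale_jensen l k :
  {ae mu, forall z, (supermartingale l k.+1 z)%:E <=
    \int[mu]_z' (supermartingale l k z * gauss_weight l (increment k z z'))%:E}%E.
Proof.
(* By Fubini, the sections of [f] at both splices are square-integrable for almost every [z]; this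
   is the source of the exceptional null set. *)
have /= := ae_integrable1 (integrable_splice k if2).
have /= := ae_integrable1 (integrable_splice k.+1 if2).
apply: filterS2 => z i1 i0.
have m1 : measurable_fun setT (fun z' => f (splice k.+1 z z')).
  by apply: measurableT_comp => //; exact: measurable_splice1.
have m0 : measurable_fun setT (fun z' => f (splice k z z')).
  by apply: measurableT_comp => //; exact: measurable_splice1.
have j1 := integrable_of_sqr m1 i1.
have j0 := integrable_of_sqr m0 i0.
have iinc : mu.-integrable setT (fun z' => (increment k z z')%:E).
  by under eq_fun do rewrite EFinB; exact: integrableB.
have iinc2 : mu.-integrable setT (fun z' => (increment k z z' ^+ 2)%:E).
  apply: (@le_integrable _ _ _ mu setT _ _ (fun z' => 2%:E *
      ((f (splice k.+1 z z') ^+ 2)%:E + (f (splice k z z') ^+ 2)%:E))%E) => //.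
  - by apply/measurable_EFinP; apply: measurable_funX; exact: measurable_increment1.
  - move=> z' _; rewrite /= lee_fin !ger0_norm ?sqr_ge0 //; last first.
      by rewrite mulr_ge0 // addr_ge0 ?sqr_ge0.
    rewrite -subr_ge0; have -> : forall a b : R, 2 * (a ^+ 2 + b ^+ 2) - (a - b) ^+ 2 =
      (a + b) ^+ 2 by move=> a b; ring.
    exact: sqr_ge0.
  - by apply: integrableZl => //; exact: integrableD.
pose psi z' := l * increment k z z' - l ^+ 2 / 2 * increment k z z' ^+ 2.
have psiE z' : (psi z')%:E = (l%:E * (increment k z z')%:E -
    (l ^+ 2 / 2)%:E * (increment k z z' ^+ 2)%:E)%E by rewrite -!EFinM -EFinB.
have ia : mu.-integrable setT (fun z' => l%:E * (increment k z z')%:E)%E.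
  exact: integrableZl.
have ib : mu.-integrable setT (fun z' => (l ^+ 2 / 2)%:E * (increment k z z' ^+ 2)%:E)%E.
  exact: integrableZl.
have ipsi : mu.-integrable setT (fun z' => (psi z')%:E).
  by under eq_fun do rewrite psiE; exact: integrableB.
have -> : supermartingale l k.+1 z = supermartingale l k z *
    expR (fine (\int[mu]_z' (psi z')%:E)).
  rewrite /supermartingale -expRD big_ord_recr /=; congr expR.
  have -> : (\int[mu]_z' (psi z')%:E = l%:E * \int[mu]_z' (increment k z z')%:E
      - (l ^+ 2 / 2)%:E * evariance k z)%E.
    under eq_integral do rewrite psiE.
    by rewrite integralB // !integralZl.
  have -> : (\int[mu]_z' (increment k z z')%:E =
      (tail_mean k.+1 z)%:E - (tail_mean k z)%:E)%E.
    under eq_integral do rewrite EFinB.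
    by rewrite integralB // /tail_mean !fineK // integrable_fin_num.
  have vfin : evariance k z \is a fin_num by exact: integrable_fin_num.
  by rewrite -[in RHS](fineK vfin) -EFinB /=; ring.
set c := fine _.
under eq_integral do rewrite EFinM.
rewrite ge0_integralZl //; last 3 first.
- apply/measurable_EFinP; apply: measurableT_comp; last exact: measurable_increment1.
  exact: measurable_gauss_weight.
- by move=> z' _; rewrite lee_fin expR_ge0.
- by rewrite lee_fin expR_ge0.
rewrite EFinM lee_pmul2l ?lte_fin ?expR_gt0 //.
exact: expR_jensen.
Qed.

(** Symmetrisation: after the Jensen bound, exchanging coordinate [k] preserves the double integral,
    leaves the stage-[k] factor alone and flips the sign of the increment. By [gauss_weightN] the
    two weights sum to at most 2. *)
Lemma supermartingale_step l (k : 'I_n) :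
  (\int[mu]_z (supermartingale l k.+1 z)%:E <=
   \int[mu]_z (supermartingale l k z)%:E)%E.
Proof.
pose phi (p : prodT Z * prodT Z) : \bar R :=
  (supermartingale l k p.1 * gauss_weight l (increment k p.1 p.2))%:E.
have mphi : measurable_fun setT phi.
  apply/measurable_EFinP; apply: measurable_funM.
    exact: measurableT_comp (measurable_supermartingale l k) measurable_fst.
  exact: measurableT_comp (measurable_gauss_weight l) (measurable_increment k).
have phi0 p : (0 <= phi p)%E by rewrite lee_fin mulr_ge0 // expR_ge0.
apply: (@le_trans _ _ (\int[mu]_z \int[mu]_z' phi (z, z'))%E).
  apply: ae_ge0_le_integral => //.
  - by move=> z _; rewrite lee_fin expR_ge0.
  - by apply/measurable_EFinP; exact: measurable_supermartingale.
  - by move=> z _; apply: integral_ge0.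
  - exact: measurable_fun_fubini_tonelli_F.
  - by have := supermartingale_jensen l k; apply: filterS => z.
set J := (X in (_ <= X)%E).
rewrite -(fubini_tonelli1 phi) //; set I := (X in (X <= _)%E).
(* Doubling reflects the order even at infinite values, so the two forms of [I] are added rather
   than averaged. *)
suff II : (I + I <= J + J)%E.
  by rewrite leNgt; apply/negP => JI; move: II; rewrite leNgt lteD.
have {2}-> : I = (\int[mu \x mu]_p phi (exchange (predC1 k) p))%E.
  by rewrite (integral_exchange mu_box).
have mphix : measurable_fun setT (fun p => phi (exchange (predC1 k) p)).
  exact: measurableT_comp mphi (measurable_exchange _).
rewrite -ge0_integralD // -ge0_integralD //; last 4 first.
- by move=> z _; rewrite lee_fin expR_ge0.
- by apply/measurable_EFinP; exact: measurable_supermartingale.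
- by move=> z _; rewrite lee_fin expR_ge0.
- by apply/measurable_EFinP; exact: measurable_supermartingale.
pose psi (p : prodT Z * prodT Z) : \bar R :=
  ((supermartingale l k p.1)%:E + (supermartingale l k p.1)%:E)%E.
have mpsi : measurable_fun setT psi.
  apply: emeasurable_funD; apply/measurable_EFinP;
  exact: measurableT_comp (measurable_supermartingale l k) measurable_fst.
have psi0 p : (0 <= psi p)%E by rewrite adde_ge0 // lee_fin expR_ge0.
have -> : (\int[mu]_z ((supermartingale l k z)%:E + (supermartingale l k z)%:E) =
    \int[mu \x mu]_p psi p)%E.
  rewrite (fubini_tonelli1 psi) //; apply: eq_integral => z _.
  by rewrite -[LHS]mule1 -(probability_setT mu) -integral_cst.
apply: ge0_le_integral => //.
- by move=> p _; rewrite adde_ge0.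
- exact: emeasurable_funD.
move=> -[z z'] _; rewrite /phi /psi /exchange /= -!EFinD lee_fin.
rewrite supermartingale_mix; last by move=> i ik /=; rewrite -val_eqE /= ltn_eqF.
have -> : increment k (mix (predC1 k) z z') (mix (predC1 k) z' z) = - increment k z z'.
  by rewrite /increment !splice_exchange opprB.
rewrite -mulrDr -mulr2n -mulr_natr ler_pM2l ?expR_gt0 //; exact: gauss_weightN.
Qed.

(** The stages are chained by induction: at [k = 0] the splice forgets [z] and the value is the
    constant [exp (l c)]; at [k = n] it forgets [z'] and [tail_mean n] is [f]. Dividing by
    [exp (l c)] centres [f]. *)
Lemma subgaussian_variance_proxy l :
  (\int[mu]_z (expR (l * (f z - fine (\int[mu]_z' (f z')%:E)) -
     l ^+ 2 / 2 * \sum_(k < n) fine (evariance k z)))%:E <= 1)%E.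
Proof.
set c := fine _.
have H k : (k <= n)%N ->
    (\int[mu]_z (supermartingale l k z)%:E <= (expR (l * c))%:E)%E.
  elim: k => [_|k IH kn]; last first.
    exact: le_trans (supermartingale_step l (Ordinal kn)) (IH (ltnW kn)).
  rewrite (eq_integral (fun=> (expR (l * c))%:E)); last first.
    move=> z _; rewrite /supermartingale big_ord0 mulr0 subr0 /tail_mean.
    by under eq_integral do rewrite splice0.
  by rewrite integral_cst // [X in (_ * X)%E](probability_setT mu) mule1.
have := H n (leqnn n).
rewrite (eq_integral (fun z => (expR (l * c))%:E * (expR (l * (f z - c) -
     l ^+ 2 / 2 * \sum_(k < n) fine (evariance k z)))%:E)%E); last first.
  move=> z _; rewrite /supermartingale /tail_mean.
  under eq_integral do rewrite splice_all.
  rewrite integral_cst // [X in (_ * X)%E](probability_setT mu) mule1 /=.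
  by rewrite -EFinM -expRD; congr (expR _)%:E; ring.
rewrite ge0_integralZl //; last first.
- apply/measurable_EFinP; apply: measurableT_comp => //; apply: measurable_funB.
    by apply: measurable_funM => //; exact: measurable_funB.
  apply: measurable_funM => //; apply: measurable_sum => k.
  apply: measurableT_comp; [exact: fine_measurable|exact: measurable_evariance].
rewrite -[leRHS]mule1 lee_pmul2l //.
by rewrite lte_fin expR_gt0.
Qed.

End Subgaussian.

(** * Passing to the sample space *)

Section ProbabilityComplements.
Context {R : realType} d {T : measurableType d} (P : probability T R).

(** The bound for positive [y] applies to [y + 1 / (k + 1)]. The corresponding events increase to
    the desired one, so continuity from below includes the case [y = 0]. *)
Lemma mixture_tail_mean_ge0 (A W : T -> R) (y x : R) :
  measurable_fun setT A -> measurable_fun setT W -> (forall w, 0 <= W w) ->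
  (forall l, (\int[P]_w (expR (l * A w - l ^+ 2 / 2 * W w))%:E <= 1)%E) ->
  0 <= y -> 0 < x -> (\int[P]_w (W w)%:E <= y%:E)%E ->
  (P [set w | (4 * (W w + y) * x < A w ^+ 2)%R]
     <= (Num.sqrt 2 * expR (- x))%:E)%E.
Proof.
move=> mA mW W0 subg y0 x0 EW.
pose yk (k : nat) := y + k.+1%:R^-1.
pose E k := [set w | (4 * (W w + yk k) * x < A w ^+ 2)%R].
have yk0 k : 0 < yk k by rewrite ltr_wpDl // invr_gt0.
have mE k : measurable (E k).
  apply: measurable_set_lt; last exact: measurable_funX.
  by apply: measurable_funM => //; apply: measurable_funM => //; exact: measurable_funD.
have -> : [set w | (4 * (W w + y) * x < A w ^+ 2)%R] = \bigcup_k E k.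
  apply/seteqP; split=> w /=; last first.
    move=> [k _]; apply: lt_trans; rewrite ltr_pM2r // ltr_pM2l // ltrD2l.
    by rewrite /yk ltrDl invr_gt0.
  (* [e] is the room left by the strict inequality: adding to [y] any amount below [e] keeps it
     strict. *)
  move=> Aw; pose e := (A w ^+ 2 - 4 * (W w + y) * x) / (4 * x).
  have e0 : 0 < e by rewrite divr_gt0 ?subr_gt0 // mulr_gt0.
  have [k ke] := ltr_add_invr (y := 0) (x := e) e0.
  exists k => //; rewrite /E /= /yk addrA.
  rewrite add0r in ke.
  have : k.+1%:R^-1 * (4 * x) < e * (4 * x) by rewrite ltr_pM2r // mulr_gt0.
  have x4 : 4 * x != 0 by rewrite gt_eqF // mulr_gt0.
  rewrite /e divfK // ltrBrDr; apply: le_lt_trans.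
  by rewrite le_eqVlt; apply/orP; left; apply/eqP; ring.
have ndE : nondecreasing_seq E.
  move=> i j ij; apply/subsetPset => w; rewrite /E /=; apply: le_lt_trans.
  rewrite ler_pM2r // ler_pM2l // lerD2l /yk lerD2l.
  by rewrite lef_pV2 ?posrE // ler_nat.
have cE : P (E k) @[k --> \oo] --> P (\bigcup_k E k).
  by apply: nondecreasing_cvg_mu => //; exact: bigcupT_measurable.
rewrite -(cvg_lim _ cE) //; apply: lime_le; first by apply/cvg_ex; eexists; exact: cE.
apply: nearW => k; apply: mixture_tail_mean => //.
apply: le_trans EW _; rewrite lee_fin /yk lerDl; exact: ltW.
Qed.

Lemma le_probability (G N E : set T) (c : R) :
  measurable G -> measurable N -> measurable E ->
  P N = 0%E -> (P E <= c%:E)%E -> (forall w, ~ N w -> ~ E w -> G w) ->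
  ((1 - c)%:E <= P G)%E.
Proof.
move=> mG mN mE PN PE NEG.
have PGC : (P (~` G) <= c%:E)%E.
  apply: (@le_trans _ _ (P (N `|` E))).
    apply: le_measure; rewrite ?inE; [exact: measurableC|exact: measurableU|].
    move=> w /= Gw; have [Nw|Nw] := pselect (N w); first by left.
    by right; apply: contrapT => Ew; apply: Gw; exact: NEG.
  apply: le_trans (measureU2 _ mN mE) _.
  by rewrite [X in (X + _)%E]PN add0e.
have PGf : P G \is a fin_num by rewrite fin_num_measure.
rewrite probability_setC // in PGC.
by rewrite EFinB leeBlDr // -leeBlDl.
Qed.

(** On [E] the function [g - V] is positive with integral zero, so [E] is null. Integrability of [V]
    passes to [g] on [E], which allows the subtraction although [g] may take infinite values. *)
Lemma ae_le_of_integral_eq (V : T -> R) (g : T -> \bar R)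
    (E := [set w | ((V w)%:E < g w)%E]) :
  P.-integrable setT (fun w => (V w)%:E) -> measurable_fun setT g ->
  (forall w, (0 <= g w)%E) ->
  (\int[P]_(w in E) (V w)%:E = \int[P]_(w in E) g w)%E ->
  {ae P, forall w, (g w <= (V w)%:E)%E}.
Proof.
move=> iV mg g0 Vg.
have mV := measurable_int _ iV.
have mE : measurable E by have := measurable_lte measurableT mV mg; rewrite setTI.
have iVE : P.-integrable E (fun w => (V w)%:E) by exact: integrableS iV.
have igE : P.-integrable E g.
  apply/integrableP; split; first exact: measurable_funTS.
  under eq_integral do rewrite gee0_abs //.
  by rewrite -Vg ltey_eq integrable_fin_num.
have idE : P.-integrable E (fun w => g w - (V w)%:E)%E by exact: integrableB.
have : (\int[P]_(w in E) `|g w - (V w)%:E| = 0)%E.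
  rewrite (eq_integral (fun w => g w - (V w)%:E))%E; last first.
    by move=> w; rewrite inE => Ew; rewrite gee0_abs // sube_ge0 // ltW.
  by rewrite integralB // Vg subee // integrable_fin_num.
move/(ae_eq_integral_abs _ mE (measurable_int _ idE)); apply: filterS => w /= Ew0.
rewrite leNgt; apply/negP => Ew; have /= g_V := Ew0 Ew.
by move: Ew; rewrite -sube_gt0 g_V ltxx.
Qed.

End ProbabilityComplements.

(** * The variance proxy along [S] and the conditional expectations *)

Section Transfer.
Context {R : realType} dO {O : measurableType dO} (P : probability O R).
Context {n : nat} {d : 'I_n -> measure_display} {Z : forall i, measurableType (d i)}.
Variables (S S' : O -> forall i, Z i).
Hypothesis mS : forall i, measurable_fun setT (fun w => S w i).
Hypothesis mS' : forall i, measurable_fun setT (fun w => S' w i).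
Hypothesis indepS : coord_independent P S.
Hypothesis copyS : independent_copy P S S'.

Let mSZ : measurable_fun setT (S : O -> prodT Z).
Proof. exact: measurable_prodT. Qed.

Let mSZ' : measurable_fun setT (S' : O -> prodT Z).
Proof. exact: measurable_prodT. Qed.

Let SX : {mfun O >-> prodT Z} :=
  HB.pack (S : O -> prodT Z) (isMeasurableFun.Build _ _ _ _ _ mSZ).

Let mu : probability (prodT Z) R := distribution P SX.

Let coord_law i (B : set (Z i)) : R := fine (P ((fun w => S w i) @^-1` B)).

Let mu_box A : (forall i, measurable (A i)) ->
  mu (box A) = (\prod_(i < n) coord_law (A i))%:E.
Proof.
move=> mA; rewrite -indepS //; congr (P _).
by apply/seteqP; split=> [w wA i _|w wA i]; [exact: wA|exact: wA].
Qed.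

(** [S] and [S'] are independent with common law [mu], so their joint law agrees with [mu \x mu] on
    rectangles, hence everywhere. *)
Lemma integral_joint_law (phi : prodT Z * prodT Z -> \bar R) :
  measurable_fun setT phi -> (forall p, (0 <= phi p)%E) ->
  (\int[P]_w phi (S w, S' w) = \int[mu \x mu]_p phi p)%E.
Proof.
move=> mphi phi0.
have mSS : measurable_fun setT (fun w => (S w, S' w) : prodT Z * prodT Z).
  exact: measurable_fun_pair.
rewrite -(@ge0_integral_pushforward _ _ _ _ _ _ mSS P setT phi) //.
apply: eq_measure_integral => A mA _.
apply/esym; apply: product_measure_unique => // B C mB mC.
rewrite /pushforward /=.
have [SS' SxS'] := copyS.
by rewrite [LHS](SxS' _ _ mB mC) -(SS' _ mC).
Qed.

Variable f : (forall i, Z i) -> R.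
Hypothesis pmf : prod_measurable f.

Let mf : measurable_fun [set: prodT Z] f.
Proof. by move=> _ B mB; rewrite setTI; exact: pmf. Qed.

(** Freezing the coordinates after index [k] at [point] packs the first [k + 1] coordinates of [S]
    into a single map, whose pullback sigma-algebra contains the generators. *)
Lemma sigma_first_preimage (k : 'I_n) (A : set O) : sigma_first S k A ->
  exists2 B : set (prodT Z), measurable B &
    A = (fun w => splice k.+1 (S w) point) @^-1` B.
Proof.
pose h (w : O) : prodT Z := splice k.+1 (S w) point.
suff : sigma_first S k `<=` preimage_set_system setT h measurable.
  by move=> /[apply] -[B mB <-]; exists B => //; rewrite setTI.
apply: smallest_sub.
  exact/sigma_algebra_preimage/sigma_algebra_measurable.
move=> _ [i [B [ik [mB ->]]]].
exists ((fun z : prodT Z => z i) @^-1` B).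
  by have := measurable_coord (i := i) measurableT mB; rewrite setTI.
by rewrite setTI /h /splice /mix; apply/seteqP; split=> w /=; rewrite ltnS ik.
Qed.

(** [evariance k] ignores the coordinates after index [k], so along [S] it is measurable for
    [sigma_first S k]. The event is therefore an admissible test set in [is_cond_exp]. *)
Lemma sigma_first_evariance (k : 'I_n) (V : O -> R) :
  (forall B : set R, measurable B -> sigma_first S k (V @^-1` B)) ->
  sigma_first S k [set w | ((V w)%:E < evariance mu f k (S w))%E].
Proof.
move=> mV.
pose gens : set (set O) := [set B | exists i (A : set (Z i)), (i <= k)%N /\
  measurable A /\ B = (fun w => S w i) @^-1` A].
pose T := g_sigma_algebraType gens.
have mVT : measurable_fun setT (V : T -> R).
  by move=> _ B mB; rewrite setTI; exact: mV.
have mh : measurable_fun setT (fun w : T => splice k.+1 (S w) point : prodT Z).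
  apply: measurable_prodT => i; rewrite /splice /mix.
  case: (boolP (i < k.+1)%N) => ik; last exact: measurable_cst.
  by move=> _ B mB; rewrite setTI; apply: sub_sigma_algebra; exists i, B.
have mg : measurable_fun setT (fun w : T => evariance mu f k (S w)).
  have -> : (fun w : T => evariance mu f k (S w)) =
      evariance mu f k \o (fun w : T => splice k.+1 (S w) point : prodT Z).
    apply/funext => w /=; apply: eq_integral => z' _.
    rewrite /increment !splice_mix // => i ik; exact: ltnW.
  by apply: measurableT_comp mh; exact: measurable_evariance.
have /measurable_EFinP mVT' := mVT.
by have := measurable_lte measurableT mVT' mg; rewrite setTI.
Qed.

(** For independent draws [z], [z'] in place of [S], [S'], swap the coordinates after index [k]: the
    event is unaffected, [f (S w)] becomes [f] at [splice k.+1 z z'], and the resampled value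
    becomes [f] at [splice k z z']. Tonelli then averages over [z']. *)
Lemma integral_evariance (k : 'I_n) (A : set O) : measurable A -> sigma_first S k A ->
  (\int[P]_(w in A) ((f (S w) - f (replace_at S S' k w)) ^+ 2)%:E =
   \int[P]_(w in A) evariance mu f k (S w))%E.
Proof.
move=> mA /sigma_first_preimage[B mB AB].
pose Q (i : 'I_n) := (i < k.+1)%N.
pose B' : set (prodT Z) := [set z | B (splice k.+1 z point)].
have mB' : measurable B'.
  have mh : measurable_fun setT (fun z : prodT Z => splice k.+1 z point).
    by apply: measurable_mix; [exact: measurable_id|exact: measurable_cst].
  by have := mh measurableT B mB; rewrite setTI.
have AB' w : \1_A w = \1_B' (S w) :> R by rewrite AB.
have B'splice z z' : \1_B' (splice k.+1 z z') = \1_B' z :> R.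
  have B'E : B' (splice k.+1 z z') = B' z by rewrite /B' /= splice_mix.
  by rewrite !indicE; congr ((nat_of_bool _)%:R); apply/idP/idP; rewrite !in_setE B'E.
pose phi (p : prodT Z * prodT Z) : \bar R :=
  (\1_B' p.1 * (f p.1 - f (mix (predC1 k) p.1 p.2)) ^+ 2)%:E.
have m1 : measurable_fun setT (fun p : prodT Z * prodT Z => \1_B' p.1 : R).
  by apply: measurableT_comp measurable_fst; exact: measurable_indic.
have mphi : measurable_fun setT phi.
  apply/measurable_EFinP; apply: measurable_funM => //.
  apply: measurable_funX; apply: measurable_funB.
    exact: measurableT_comp mf measurable_fst.
  apply: measurableT_comp mf _.
  by apply: measurable_mix; [exact: measurable_fst|exact: measurable_snd].
have phi0 p : (0 <= phi p)%E by rewrite lee_fin mulr_ge0 ?sqr_ge0.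
have mev : measurable_fun setT (fun z => ((\1_B' z)%:E * evariance mu f k z)%E).
  apply: emeasurable_funM; last exact: measurable_evariance.
  by apply/measurable_EFinP; exact: measurable_indic.
transitivity (\int[P]_w phi (S w, S' w))%E.
  rewrite integral_mkcond; apply: eq_integral => w _.
  rewrite epatch_indic /phi /= AB' EFinM muleC; congr (_ * _%:E)%E.
  congr ((f _ - f _) ^+ 2).
  apply: functional_extensionality_dep => i.
  by rewrite /replace_at /mix /=; case: eqP.
rewrite integral_joint_law // -(integral_exchange (m := coord_law) mu_box Q) //.
transitivity (\int[mu \x mu]_p
    (\1_B' p.1 * (increment f k p.1 p.2) ^+ 2)%:E)%E.
  apply: eq_integral => -[z z'] _; rewrite /phi /exchange /=.
  rewrite -[mix Q z z']/(splice k.+1 z z') B'splice /increment; congr (_ * (f _ - f _) ^+ 2)%:E.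
  apply: functional_extensionality_dep => i.
  rewrite /splice /mix /= /Q ltnS -val_eqE /=; by case: ltngtP.
rewrite fubini_tonelli1; last 2 first.
- apply/measurable_EFinP; apply: measurable_funM => //.
  by apply: measurable_funX; exact: measurable_increment.
- by move=> p; rewrite lee_fin mulr_ge0 ?sqr_ge0.
transitivity (\int[mu]_z ((\1_B' z)%:E * evariance mu f k z))%E.
  apply: eq_integral => z _; rewrite /fubini_F /=.
  under eq_integral do rewrite EFinM.
  rewrite ge0_integralZl //.
  - by apply/measurable_EFinP; apply: measurable_funX; exact: measurable_increment1.
  - by move=> z' _; rewrite lee_fin sqr_ge0.
rewrite ge0_integral_distribution //; last first.
  by move=> z; rewrite mule_ge0 ?lee_fin // evariance_ge0.
rewrite [RHS]integral_mkcond; apply: eq_integral => w _.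
by rewrite epatch_indic /= AB' muleC.
Qed.

Lemma evariance_le_cond_exp (k : 'I_n) (V : O -> R) :
  is_cond_exp P (sigma_first S k)
    (fun w => (f (S w) - f (replace_at S S' k w)) ^+ 2) V ->
  {ae P, forall w, (evariance mu f k (S w) <= (V w)%:E)%E}.
Proof.
move=> [mV [iV VY]].
have mev : measurable_fun setT (fun w => evariance mu f k (S w)).
  by apply: measurableT_comp mSZ; exact: measurable_evariance.
have sE := sigma_first_evariance mV.
apply: ae_le_of_integral_eq => //; first by move=> w; exact: evariance_ge0.
rewrite VY // integral_evariance //.
have := measurable_lte measurableT (measurable_int _ iV) mev.
by rewrite setTI.
Qed.

Hypothesis iff2 : P.-integrable setT (fun w => (f (S w) ^+ 2)%:E).

Lemma subgaussian_transfer l :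
  (\int[P]_w (expR (l * (f (S w) - fine ('E_P[fun w => f (S w)])%E) -
     l ^+ 2 / 2 * \sum_(k < n) fine (evariance mu f k (S w))))%:E <= 1)%E.
Proof.
have imu (g : prodT Z -> R) : measurable_fun setT g ->
    P.-integrable setT (fun w => (g (S w))%:E) -> mu.-integrable setT (fun z => (g z)%:E).
  move=> mg /integrableP[_ ig]; apply/integrableP; split.
    exact/measurable_EFinP.
  rewrite ge0_integral_distribution //.
  by apply: measurableT_comp => //; exact/measurable_EFinP.
have if2 : mu.-integrable setT (fun z => (f z ^+ 2)%:E).
  by apply: (imu (fun z => f z ^+ 2)) => //; exact: measurable_funX.
have mfS : measurable_fun setT (fun w => f (S w)) by exact: measurableT_comp mf mSZ.
have -> : ('E_P[fun w => f (S w)] = \int[mu]_z (f z)%:E)%E.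
  rewrite unlock integral_distribution //; first exact/measurable_EFinP.
  exact: integrable_of_sqr.
have := subgaussian_variance_proxy (m := coord_law) mu_box mf if2 l.
rewrite ge0_integral_distribution //.
apply/measurable_EFinP; apply: measurableT_comp => //; apply: measurable_funB.
  by apply: measurable_funM => //; exact: measurable_funB.
apply: measurable_funM => //; apply: measurable_sum => k.
by apply: measurableT_comp; [exact: fine_measurable|exact: measurable_evariance].
Qed.

Lemma measurable_sum_evariance :
  measurable_fun setT (fun w => \sum_(k < n) fine (evariance mu f k (S w))).
Proof.
apply: measurable_sum => k; apply: measurableT_comp; first exact: fine_measurable.
by apply: measurableT_comp mSZ; exact: measurable_evariance.
Qed.

(* [W] is a version of [V] which dominates the variance proxy everywhere, so
   that the exceptional null set disappears from the moment bound. *)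
Lemma dominating_version (Vk : 'I_n -> O -> R) (V := fun w => \sum_(k < n) Vk k w) :
  (forall k, is_cond_exp P (sigma_first S k)
      (fun w => (f (S w) - f (replace_at S S' k w)) ^+ 2) (Vk k)) ->
  exists W : O -> R, [/\ measurable_fun setT W, forall w, 0 <= W w,
    {ae P, forall w, W w = V w} &
    forall l, (\int[P]_w (expR (l * (f (S w) - fine ('E_P[fun w => f (S w)])%E) -
     l ^+ 2 / 2 * W w))%:E <= 1)%E].
Proof.
move=> condV.
have mVk k : measurable_fun setT (Vk k).
  by apply/measurable_EFinP; have [_ [iV _]] := condV k; exact: measurable_int iV.
have mV : measurable_fun setT V by apply: measurable_sum => k.
have mfS : measurable_fun setT (fun w => f (S w)) by exact: measurableT_comp mf mSZ.
pose v w := \sum_(k < n) fine (evariance mu f k (S w)).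
have v0 w : 0 <= v w by apply: sumr_ge0 => k _; rewrite fine_ge0 // evariance_ge0.
have mv : measurable_fun setT v by exact: measurable_sum_evariance.
have mexp (U : O -> R) l : measurable_fun setT U -> measurable_fun setT
    (fun w => (expR (l * (f (S w) - fine ('E_P[fun w => f (S w)])%E) -
     l ^+ 2 / 2 * U w))%:E).
  move=> mU; apply/measurable_EFinP; apply: measurableT_comp => //.
  apply: measurable_funB; last exact: measurable_funM.
  by apply: measurable_funM => //; exact: measurable_funB.
have mW : measurable_fun setT (fun w => Num.max (V w) (v w)).
  exact: measurable_maxr.
exists (fun w => Num.max (V w) (v w)); split=> //.
- by move=> w; rewrite le_max v0 orbT.
- have : {ae P, forall w, forall k : 'I_n, (evariance mu f k (S w) <= (Vk k w)%:E)%E}.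
    by apply: filter_forall => k; exact: evariance_le_cond_exp.
  apply: filterS => w vV; apply/max_idPl; apply: ler_sum => k _.
  (* Domination by the real number [Vk k w] makes [evariance] finite, so [fine] is faithful here. *)
  rewrite -lee_fin; apply: le_trans (vV k).
  by rewrite fineK // ge0_fin_numE ?evariance_ge0 // (le_lt_trans (vV k)) ?ltry.
(* A larger penalty lowers the exponential, so the bound for [v] passes to the maximum. *)
- move=> l; apply: le_trans (subgaussian_transfer l).
  apply: ge0_le_integral => //; try exact: mexp.
  move=> w _; rewrite lee_fin ler_expR lerD2l lerN2 ler_wpM2l ?divr_ge0 ?sqr_ge0 //.
  by rewrite le_max lexx orbT.
Qed.

End Transfer.

(** * Deviation bounds for [f(S)] by the semi-empirical variance proxy *)

Theorem theorem1 (R : realType) (dO : measure_display) (O : measurableType dO)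
  (P : probability O R) (n : nat) (d : 'I_n -> measure_display)
  (Z : forall i : 'I_n, measurableType (d i))
  (S S' : O -> forall i : 'I_n, Z i) (f : (forall i : 'I_n, Z i) -> R)
  (Vk : 'I_n -> O -> R) :
  (1 <= n)%N ->
  (forall i, measurable_fun setT (fun w => S w i)) ->
  (forall i, measurable_fun setT (fun w => S' w i)) ->
  coord_independent P S ->
  independent_copy P S S' ->
  prod_measurable f ->
  P.-integrable setT (fun w => ((f (S w)) ^+ 2)%:E) ->
  (forall k : 'I_n, is_cond_exp P (sigma_first S k)
      (fun w => (f (S w) - f (replace_at S S' k w)) ^+ 2) (Vk k)) ->
  let Delta := fun w => f (S w) - fine ('E_P[fun w => f (S w)])%E in
  let V := fun w => \sum_(k < n) Vk k w in
  (forall y x : R, 0 < y -> 2 <= x ->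
    (P [set w | (`|Delta w| <=
        Num.sqrt (2 * (V w + y) * (1 + ln (1 + V w / y) / 2) * x))%R]
     >= ((1 - expR (- x))%R)%:E)%E) /\
  (forall x : R, 0 < x ->
    (P [set w | (`|Delta w| <=
        2 * Num.sqrt ((V w + fine ('E_P[V])%E) * x))%R]
     >= ((1 - Num.sqrt 2 * expR (- x))%R)%:E)%E).
Proof.
move=> _ mS mS' indepS copyS pmf if2 condV Delta V.
have [W [mW W0 WV subg]] := dominating_version mS mS' indepS copyS pmf if2 condV.
have mfS : measurable_fun setT (fun w => f (S w)).
  have mSZ : measurable_fun setT (S : O -> prodT Z) by exact: measurable_prodT.
  apply: (measurableT_comp (f := (f : prodT Z -> R)) _ mSZ) => _ B mB.
  by rewrite setTI; exact: pmf.
have mD : measurable_fun setT Delta by exact: measurable_funB.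
have iVk k : P.-integrable setT (fun w => (Vk k w)%:E) by have [_ []] := condV k.
have mV : measurable_fun setT V.
  by apply: measurable_sum => k; apply/measurable_EFinP; exact: measurable_int (iVk k).
have mgood (g : O -> R) : measurable_fun setT g -> measurable [set w | `|Delta w| <= g w].
  move=> mg; have -> : [set w | `|Delta w| <= g w] = ~` [set w | g w < `|Delta w|].
    by apply/seteqP; split=> w /=; rewrite leNgt => /negP.
  by apply: measurableC; apply: measurable_set_lt => //; exact: measurableT_comp.
have msqrt (g : O -> R) : measurable_fun setT g -> measurable_fun setT (fun w => Num.sqrt (g w)).
  by apply: measurableT_comp; apply: continuous_measurable_fun; exact: sqrt_continuous.
have [N [mN PN WVN]] := WV.
have WVE w : ~ N w -> W w = V w by move=> Nw; apply: contrapT => ?; apply: Nw; exact: WVN.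
have absD w : `|Delta w| = Num.sqrt (Delta w ^+ 2) by rewrite sqrtr_sqr.
have mtail (g : O -> R) : measurable_fun setT g -> measurable [set w | g w < Delta w ^+ 2].
  by move=> mg; apply: measurable_set_lt => //; exact: measurable_funX.
split=> [y x y0 x2|x x0].
- have mbound (U : O -> R) : measurable_fun setT U -> measurable_fun setT
      (fun w => 2 * (U w + y) * (1 + ln (1 + U w / y) / 2) * x).
    move=> mU; apply: measurable_funM => //; apply: measurable_funM.
      by apply: measurable_funM => //; exact: measurable_funD.
    apply: measurable_funD => //; apply: measurable_funM => //.
    apply: measurableT_comp; first exact: measurable_ln.
    by apply: measurable_funD => //; exact: measurable_funM.
  have x1 : 1 <= x by apply: le_trans x2; rewrite ler1n.
  apply: (le_probability _ mN _ PN (mixture_tail mD mW W0 y0 subg x1)).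
  + by apply: mgood; apply: msqrt; exact: mbound.
  + by apply: mtail; exact: mbound.
  (* Off the null set [N] the version [W] is [V], and outside the tail event the bound on [Delta^2]
     yields the one on [|Delta|] by taking square roots. *)
  move=> w Nw /negP; rewrite -leNgt WVE // => DV.
  by rewrite /= absD; exact: ler_wsqrtr.
- set e := fine _.
  (* [W] and [V] agree almost everywhere, so [e = E V] is an admissible value of [y] in the tail
     bound for [W]. *)
  have EVE : (\int[P]_w (W w)%:E = e%:E)%E.
    have iV : P.-integrable setT (fun w => (V w)%:E).
      have -> : (fun w => (V w)%:E) = (fun w => \sum_(k < n) (Vk k w)%:E)%E.
        by apply/funext => w; rewrite sumEFin.
      by apply: integrable_sum => // k _.
    rewrite /e unlock fineK ?integrable_fin_num //.
    apply: ae_eq_integral => //; try exact/measurable_EFinP.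
    by apply: filterS WV => w /= ->.
  have e0 : 0 <= e by rewrite -lee_fin -EVE; apply: integral_ge0 => w _; rewrite lee_fin.
  have mbound (U : O -> R) : measurable_fun setT U -> measurable_fun setT
      (fun w => 4 * (U w + e) * x).
    move=> mU; apply: measurable_funM => //; apply: measurable_funM => //.
    exact: measurable_funD.
  apply: (le_probability _ mN _ PN (mixture_tail_mean_ge0 mD mW W0 subg e0 x0 _)).
  + apply: mgood; apply: measurable_funM => //; apply: msqrt.
    by apply: measurable_funM => //; exact: measurable_funD.
  + by apply: mtail; exact: mbound.
  + by rewrite EVE.
  move=> w Nw /negP; rewrite -leNgt WVE // => DV.
  rewrite /= absD -[2]ger0_norm // -sqrtr_sqr -sqrtrM ?sqr_ge0 //.
  apply: ler_wsqrtr; apply: le_trans DV _.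
  by rewrite le_eqVlt; apply/orP; left; apply/eqP; ring.
Qed.
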